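(* Let $F,G,H:\mathbb{R}^2\to\mathbb{R}^2$ be the polynomial maps $$F(x,y)=\big((xy-1)^2+x^2,\ (xy-1)^2+y^2\big),$$ $$G(x,y)=\big(x,\ y(xy-2)^2+x(xy-1)^2\big),$$ $$H(x,y)=\big(x(xy-2)^2+\tfrac{1}{2}xy^2,\ y\big).$$ Then the image of the polynomial map $f:=H\circ G\circ F:\mathbb{R}^2\to\mathbb{R}^2$ is the open quadrant $\mathcal{Q}:=\{(x,y)\in\mathbb{R}^2 : x>0,\ y>0\}$, i.e. $f(\mathbb{R}^2)=\mathcal{Q}$. *)

(* Defs.v *)
From Stdlib Require Import Reals.
Local Open Scope R_scope.

Definition map_F (p : R * R) : R * R :=
  let (x, y) := p in
  ((x * y - 1) ^ 2 + x ^ 2, (x * y - 1) ^ 2 + y ^ 2).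

Definition map_G (p : R * R) : R * R :=
  let (x, y) := p in
  (x, y * (x * y - 2) ^ 2 + x * (x * y - 1) ^ 2).

Definition map_H (p : R * R) : R * R :=
  let (x, y) := p in
  (x * (x * y - 2) ^ 2 + 1 / 2 * x * y ^ 2, y).

Definition map_f (p : R * R) : R * R := map_H (map_G (map_F p)).

Definition open_quadrant (q : R * R) : Prop := 0 < fst q /\ 0 < snd q.

(* Main.v *)
(** The inclusion in the quadrant holds because each map preserves positivity.
    Conversely, every step is an application of the intermediate value theorem:
    the image of [F] contains the region [xy >= 1] of the quadrant; since [G]
    sends [(x, 1/x)] to [(x, 1/x)] and [(x, 2/x)] to [(x, x)], the image of
    [G o F] contains every [(x, y)] with [y >= min (x, 1/x)]; and [H] maps the
    part of this set at height [v] onto the whole half-line [x > 0], because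
    the first coordinate of [H] equals [v] at [x = 2/v], tends to [0] at
    [x = 0], and for [v < 1] is at least [v] at [x = v]. *)
Require Import Defs.
From Stdlib Require Import Reals Lra Psatz.
Local Open Scope R_scope.

Lemma IVT_value (f : R -> R) (a b u : R) :
  continuity f -> a <= b -> f a <= u <= f b ->
  exists c, a <= c <= b /\ f c = u.
Proof.
  intros Hf Hab Hu.
  destruct (IVT_cor (fun x => f x - u) a b) as [c [Hc Hc0]].
  - reg.
  - exact Hab.
  - nra.
  - exists c; split; [exact Hc | lra].
Qed.

(** The absolute values of [x] and [y] must be [sqrt P] and [sqrt Q]; the sign of [w] decides the
    sign given to [x]. *)
Lemma sqr_pair_with_product (P Q w : R) :
  0 <= P -> 0 <= Q -> P * Q = w ^ 2 ->
  exists x y, x ^ 2 = P /\ y ^ 2 = Q /\ x * y = w.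
Proof.
  intros HP HQ HPQ.
  assert (E : sqrt P * sqrt Q = Rabs w).
  { rewrite <- sqrt_mult, HPQ by assumption.
    rewrite <- sqrt_Rsqr_abs; f_equal; unfold Rsqr; ring. }
  pose proof (pow2_sqrt P HP); pose proof (pow2_sqrt Q HQ).
  destruct (Rle_dec 0 w) as [Hw | Hw].
  - exists (sqrt P), (sqrt Q); rewrite Rabs_pos_eq in E; auto.
  - exists (- sqrt P), (sqrt Q); rewrite Rabs_left in E by lra.
    repeat split; nra.
Qed.

(* With [s = xy - 1], solving [F (x, y) = (a, b)] amounts to finding [s] with
   [s ^ 2 <= a], [s ^ 2 <= b] and [(a - s ^ 2) * (b - s ^ 2) = (s + 1) ^ 2]. *)
Lemma map_F_image_ordered (a b : R) :
  0 < a -> a <= b -> 1 <= a * b -> exists p, map_F p = (a, b).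
Proof.
  intros Ha Hab H1.
  pose proof (sqrt_lt_R0 a Ha); pose proof (pow2_sqrt a (Rlt_le _ _ Ha)).
  (* At [- sqrt a] the product vanishes, leaving [- (1 - sqrt a) ^ 2]; at [0] the value is
     [a * b - 1]. This interval also forces [s ^ 2 <= a]. *)
  destruct (IVT_value (fun s => (a - s ^ 2) * (b - s ^ 2) - (s + 1) ^ 2)
              (- sqrt a) 0 0) as [s [Hs E]].
  - reg.
  - lra.
  - cbv beta; split; [| nra].
    replace ((- sqrt a) ^ 2) with a by (rewrite <- H0 at 1; ring).
    pose proof (pow2_ge_0 (- sqrt a + 1)); lra.
  - assert (Hsa : s ^ 2 <= a) by nra.
    destruct (sqr_pair_with_product (a - s ^ 2) (b - s ^ 2) (s + 1))
      as (x & y & Hx & Hy & Hxy); try lra.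
    exists (x, y); cbn [map_F].
    rewrite Hxy, Hx, Hy; f_equal; ring.
Qed.

Lemma map_F_image (a b : R) :
  0 < a -> 1 <= a * b -> exists p, map_F p = (a, b).
Proof.
  intros Ha H1.
  destruct (Rle_dec a b) as [Hab | Hab].
  - now apply map_F_image_ordered.
  (* [map_F] commutes with swapping the two coordinates. *)
  - destruct (map_F_image_ordered b a) as [[x y] E]; try nra.
    exists (y, x); unfold map_F in *; injection E as E1 E2.
    f_equal; rewrite (Rmult_comm y x); assumption.
Qed.

Lemma map_G_map_F_image (x y : R) :
  0 < x -> x <= y \/ / x <= y -> exists p, map_G (map_F p) = (x, y).
Proof.
  intros Hx Hy.
  assert (Hi : 0 < / x) by now apply Rinv_0_lt_compat.
  assert (Hxi : x * / x = 1) by (field; lra).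
  set (g := fun z => z * (x * z - 2) ^ 2 + x * (x * z - 1) ^ 2).
  (* At [z = y + 3 * / x] the factor [x * z - 2] equals [x * y + 1 >= 1], so [g z >= z >= y]. *)
  assert (Hend : 0 <= y -> y <= g (y + 3 * / x)).
  { intros Hy0; unfold g.
    replace (x * (y + 3 * / x)) with (x * y + 3) by (field; lra).
    assert (0 <= x * y) by nra.
    assert (1 <= (x * y + 3 - 2) ^ 2) by nra.
    assert (0 <= x * (x * y + 3 - 1) ^ 2) by nra.
    nra. }
  (* [/ x <= z] gives [1 <= x * z], as [map_F_image] requires. *)
  assert (Hz : exists z, / x <= z /\ g z = y).
  { destruct Hy as [Hy | Hy].
    - destruct (IVT_value g (2 * / x) (y + 3 * / x) y) as [z [Hz E]].
      + unfold g; reg.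
      + lra.
      + split; [| apply Hend; lra].
        unfold g; replace (x * (2 * / x)) with 2 by (field; lra); lra.
      + exists z; split; [lra | exact E].
    - destruct (IVT_value g (/ x) (y + 3 * / x) y) as [z [Hz E]].
      + unfold g; reg.
      + lra.
      + split; [| apply Hend; lra].
        unfold g; rewrite Hxi; lra.
      + exists z; split; [lra | exact E]. }
  destruct Hz as [z [Hz E]].
  destruct (map_F_image x z Hx) as [p Hp]; [nra |].
  exists p; rewrite Hp; unfold map_G; f_equal; exact E.
Qed.

Lemma map_f_surj_quadrant (u v : R) :
  0 < u -> 0 < v -> exists p, map_f p = (u, v).
Proof.
  intros Hu Hv.
  assert (Hi : 0 < / v) by now apply Rinv_0_lt_compat.
  assert (Hvi : v * / v = 1) by (field; lra).
  set (h := fun x => x * (x * v - 2) ^ 2 + 1 / 2 * x * v ^ 2).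
  assert (Ch : continuity h) by (unfold h; reg).
  assert (h0 : h 0 = 0) by (unfold h; ring).
  assert (h2 : h (2 * / v) = v) by (unfold h; field; lra).
  (* Each alternative yields [x <= v] or [/ x <= v]; for [1 <= v], because [x] and [/ x] cannot both
     exceed 1. *)
  assert (Hx : exists x, 0 <= x /\ (x <= v \/ 1 <= x * v \/ 1 <= v) /\ h x = u).
  { destruct (Rle_dec v u) as [Hvu | Hvu].
    - destruct (IVT_value h (2 * / v) (u + 3 * / v) u) as [x [Hx E]];
        [exact Ch | lra | split; [lra |] |].
      (* At this endpoint [x * v - 2 = u * v + 1 >= 1], so [h x >= x >= u]. *)
      + unfold h.
        replace ((u + 3 * / v) * v) with (u * v + 3) by (field; lra).
        assert (0 <= u * v) by nra.
        assert (1 <= (u * v + 3 - 2) ^ 2) by nra.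
        assert (0 <= (u + 3 * / v) * v ^ 2) by nra.
        nra.
      + exists x; split; [lra |]; split; [right; left; nra | exact E].
    - destruct (Rle_dec 1 v) as [H1 | H1].
      + destruct (IVT_value h 0 (2 * / v) u) as [x [Hx E]];
          [exact Ch | lra | lra |].
        exists x; split; [lra |]; split; [now right; right | exact E].
      + destruct (IVT_value h 0 v u) as [x [Hx E]];
          [exact Ch | lra | split; [lra |] |].
        (* This product is [h v - v]; both quadratic factors are positive because [v < 1]. *)
        * assert (Hq : 0 <= v * ((2 - v ^ 2) * (3 / 2 - v ^ 2)))
            by (apply Rmult_le_pos; [lra | apply Rmult_le_pos; nra]).
          replace (h v) with (v + v * ((2 - v ^ 2) * (3 / 2 - v ^ 2)))
            by (unfold h; field).
          lra.
        * exists x; split; [lra |]; split; [left; lra | exact E]. }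
  destruct Hx as (x & Hx0 & Hxv & E).
  assert (Hx : 0 < x).
  { destruct Hx0 as [Hx0 | <-]; [exact Hx0 | lra]. }
  assert (Hix : 0 < / x) by now apply Rinv_0_lt_compat.
  assert (Hxi : x * / x = 1) by (field; lra).
  destruct (map_G_map_F_image x v Hx) as [p Hp].
  { destruct Hxv as [Hxv | [Hxv | Hxv]].
    - now left.
    - right; nra.
    - destruct (Rle_dec x 1); [left; lra | right; nra]. }
  exists p; unfold map_f; rewrite Hp; unfold map_H; f_equal; exact E.
Qed.

Lemma pow2_pos (x : R) : x <> 0 -> 0 < x ^ 2.
Proof. intros Hx; rewrite <- Rsqr_pow2; now apply Rsqr_pos_lt. Qed.

Lemma map_F_quadrant (p : R * R) : open_quadrant (map_F p).
Proof.
  destruct p as [x y]; split; cbn [fst snd map_F].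
  - destruct (Req_dec x 0) as [-> | Hx]; [nra |].
    pose proof (pow2_pos x Hx); pose proof (pow2_ge_0 (x * y - 1)); lra.
  - destruct (Req_dec y 0) as [-> | Hy]; [nra |].
    pose proof (pow2_pos y Hy); pose proof (pow2_ge_0 (x * y - 1)); lra.
Qed.

Lemma map_G_quadrant (p : R * R) : open_quadrant p -> open_quadrant (map_G p).
Proof.
  destruct p as [x y]; intros [Hx Hy]; simpl in Hx, Hy.
  split; cbn [fst snd map_G]; [exact Hx |].
  pose proof (pow2_ge_0 (x * y - 2)); pose proof (pow2_ge_0 (x * y - 1)).
  destruct (Req_dec (x * y) 2) as [E | E].
  - rewrite E; lra.
  - assert (0 < (x * y - 2) ^ 2) by (apply pow2_pos; lra).
    nra.
Qed.

Lemma map_H_quadrant (p : R * R) : open_quadrant p -> open_quadrant (map_H p).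
Proof.
  destruct p as [x y]; intros [Hx Hy]; simpl in Hx, Hy.
  split; cbn [fst snd map_H]; [| exact Hy].
  pose proof (pow2_ge_0 (x * y - 2)).
  assert (0 < y ^ 2) by (apply pow2_pos; lra).
  assert (0 < x * y ^ 2) by nra.
  nra.
Qed.

Theorem mainTheorem2 :
  forall q : R * R, (exists p : R * R, map_f p = q) <-> open_quadrant q.
Proof.
  intros [u v]; split.
  - intros [p <-]; unfold map_f.
    apply map_H_quadrant, map_G_quadrant, map_F_quadrant.
  - intros [Hu Hv]; now apply map_f_surj_quadrant.
Qed.
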